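(* The expected numbers of arrivals $x_{kN}$ ($k\in\mathbb Z$) at the multiple function barriers, for the walk started in $i_0$, are given as follows. Case $\rho\neq 1$: $$x_{kN}=\begin{cases}\{(\lambda_1^{N-i_0}-\lambda_2^{N-i_0})\xi_1+\rho^N(\lambda_2^{-i_0}-\lambda_1^{-i_0})\}\,\Omega\,\xi_1^{k-1} & (k\leq 0),\\ \{(\lambda_1^{N-i_0}-\lambda_2^{N-i_0})\xi_2+\rho^N(\lambda_2^{-i_0}-\lambda_1^{-i_0})\}\,\Omega\,\xi_2^{k-1} & (k\geq 1),\end{cases}$$ where $\xi_1,\xi_2$ are the solutions of $$(\lambda_1-\lambda_2)q_0\xi_i^2+\omega_0\xi_i+(\lambda_1-\lambda_2)p_0\rho^{N-1}=0\quad(i=1,2),\qquad \xi_1>1>\xi_2>0,$$ with $$\omega_0=(\lambda_2^{N}-\lambda_1^{N})(1-r_0)+(\lambda_1^{N-1}-\lambda_2^{N-1})(p_0+q_0\rho),\qquad \Omega=\{\omega_0^2-4p_0q_0(1-\rho)^2\rho^{N-1}\}^{-\frac12}.$$ Case $\rho=1$: $$x_{kN}=\begin{cases}\dfrac{\{(N-i_0)\xi_1+i_0\}\xi_1^{k-1}}{\sqrt{(p_0+q_0+Ns_0)^2-4p_0q_0}} & (k\leq 0),\\[2ex] \dfrac{\{(N-i_0)\xi_2+i_0\}\xi_2^{k-1}}{\sqrt{(p_0+q_0+Ns_0)^2-4p_0q_0}} & (k\geq 1),\end{cases}$$ where $\xi_1,\xi_2$ are the solutions of $$q_0\xi_i^2-(p_0+q_0+Ns_0)\xi_i+p_0=0\quad(i=1,2),\qquad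 \xi_1>1>\xi_2>0.$$
   Context: Setting. Let $N>1$ be an integer. Consider a discrete-time random walk on $\mathbb Z$ with a multiple function barrier (MFB) at every point $kN$, $k\in\mathbb Z$. At each time step, a walker located at an MFB $kN$ moves to $kN+1$ with probability $p_0$, moves to $kN-1$ with probability $q_0$, stays in $kN$ with probability $r_0$, and is absorbed in that MFB (the walk ends) with probability $s_0$, where $p_0+q_0+r_0+s_0=1$, $r_0\ge 0$ and $p_0q_0s_0>0$. A walker located at a point that is not a multiple of $N$ moves one step forward ($+1$) with probability $p$, one step backward ($-1$) with probability $q$, and stays with probability $r=1-p-q\ge 0$, where $pq>0$. The walk starts in $i_0$, an integer with $0\le i_0<N$. Notation. $x_j=\sum_{m=0}^{\infty}p_{i_0j}^{(m)}$ is the expected number of arrivals in state $j$, where $p_{ij}^{(m)}$ is the probability that the walker started in $i$ is at $j$ after $m$ steps, not yet absorbed (time $0$ is counted). $\rho=p/q$. $\lambda_1\ge\lambda_2$ are the solutions of $q\lambda^2-(1-r)\lambda+p=0$; thus $\lambda_1=\rho,\lambda_2=1$ if $p>q$; $\lambda_1=1,\lambda_2=\rho$ if $p<q$; $\lambda_1=\lambda_2=1$ if $p=q$. *)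

(* Defs.v *)
From HB Require Import structures.
From mathcomp Require Export all_boot all_order all_algebra.
From mathcomp Require Export all_classical all_reals all_analysis.
Export Order.TTheory GRing.Theory Num.Theory.

Set Implicit Arguments.
Unset Strict Implicit.
Unset Printing Implicit Defensive.

Local Open Scope classical_set_scope.
Local Open Scope ring_scope.

(* {x, y} is exactly the solution set in R of a z^2 + b z + c = 0; x = y is
   allowed, for a double root. *)
Definition solutions_quadratic (R : realType) (a b c x y : R) : Prop :=
  forall z : R, a * z ^+ 2 + b * z + c = 0 <-> z = x \/ z = y.

(* X is a Markov chain on the countable state space S, started in i, with
   one-step transition probabilities K. The Markov property is
     P(X_0 = a_0, ..., X_n = a_n, X_(n+1) = b)
       = P(X_0 = a_0, ..., X_n = a_n) K(a_n, b),
   the conditional-probability version multiplied out so that histories of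
   probability 0 need no separate treatment. As S is countable, measurability
   of the fibres of X_n is measurability for the discrete sigma-algebra. *)
Definition markov_chain (R : realType) (d : measure_display)
    (T : measurableType d) (P : probability T R) (S : countType)
    (K : S -> S -> R) (i : S) (X : nat -> T -> S) : Prop :=
  [/\ forall n j, measurable [set w | X n w = j],
      P [set w | X 0 w = i] = 1%E &
      forall (n : nat) (a : nat -> S) (b : S),
        P [set w | (forall m, (m <= n)%N -> X m w = a m) /\ X n.+1 w = b] =
        (P [set w | forall m, (m <= n)%N -> X m w = a m] * (K (a n) b)%:E)%E].

(* The states are the positions [Some a], a in Z, of a walker that is still
   walking, and the state [None] of a walker that has been absorbed. *)
Definition mfb_transition (R : realType) (N : nat) (p0 q0 r0 s0 p q r : R)
    (x y : option int) : R :=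
  match x, y with
  | None, None => 1
  | None, Some _ => 0
  | Some a, None => if (N%:Z %| a)%Z then s0 else 0
  | Some a, Some b =>
      let: (forth, back, stay) :=
        if (N%:Z %| a)%Z then (p0, q0, r0) else (p, q, r) in
      if b == a + 1 then forth
      else if b == a - 1 then back
      else if b == a then stay
      else 0
  end.

(* x_j = \sum_(m >= 0) P(X_m = j), with values in [0, +oo]. *)
Definition expected_arrivals (R : realType) (d : measure_display)
    (T : measurableType d) (P : probability T R) (X : nat -> T -> option int)
    (j : int) : \bar R :=
  (\sum_(0 <= m <oo) P [set w | X m w = Some j])%E.

(* Main.v *)
Require Import Defs.
From mathcomp Require Import zify ring lra.
Import numFieldNormedType.Exports.

(* Let [K] be the transition operator acting on functions of the position of a
   walker that is not absorbed. By the Markov property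
   [P (X_m = j) = (K ^ m delta_j) i0]. If [f] is bounded and
   [f - K f = delta_(kN)], then telescoping gives [x_(kN) = f i0], because
   [K ^ m f] tends to 0: some bounded [h >= 1] satisfies [K h <= theta h] with
   [theta < 1].
   The function [f] is found in the form [F a b = H b * xi ^ (- a - 1)] at the
   point [a N + b], where [H] solves the recurrence inside a block, the equation
   at the barriers becomes the quadratic equation for [xi], and the root [xi] is
   chosen on each side of the target so that [f] is bounded. *)

Set Implicit Arguments.
Unset Strict Implicit.
Unset Printing Implicit Defensive.

Local Open Scope classical_set_scope.
Local Open Scope ring_scope.

(** * Countable fibres and Markov chains *)

Lemma pickle_fibre (T : Type) (S : countType) (Y : T -> S) (k : nat) :
  [set w | pickle (Y w) = k] =
  if @pickle_inv S k is Some s then [set w | Y w = s] else set0.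
Proof.
case E: (pickle_inv k) => [s|]; apply/seteqP; split => w //= Yw.
- by move: E; rewrite -Yw pickleK_inv => -[].
- by have := @pickle_invK S k; rewrite E /= Yw.
- by move: E; rewrite -Yw pickleK_inv.
Qed.

(** Coding [S] by naturals turns the partition of [A] by the values of [Y] into a series; a code of
    no element gives the empty set. *)
Lemma measure_countable_fibres (R : realType) (d : measure_display)
    (T : measurableType d) (mu : {measure set T -> \bar R}) (S : countType)
    (Y : T -> S) (A : set T) :
  (forall s, measurable [set w | Y w = s]) -> measurable A ->
  mu A = (\sum_(0 <= k <oo) mu (A `&` [set w | pickle (Y w) = k]))%E.
Proof.
move=> mY mA.
have mF k : measurable [set w | pickle (Y w) = k].
  by rewrite pickle_fibre; case: pickle_inv.
rewrite -measure_semi_bigcup.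
- congr (mu _); apply/seteqP; split=> w /=; last by case=> k _ [].
  by move=> Aw; exists (pickle (Y w)).
- by move=> k; exact: measurableI.
- by move=> i j _ _ [w /= [[_ <-] [_ <-]]].
- by apply: bigcup_measurable => k _; exact: measurableI.
Qed.

Section markov.
Context (R : realType) (d : measure_display) (T : measurableType d)
  (P : probability T R) (S : countType) (K : S -> S -> R) (i : S)
  (X : nat -> T -> S) (hX : markov_chain P K i X).

Let mX n j : measurable [set w | X n w = j]. Proof. by case: hX. Qed.

(** The Markov property is given for full histories. The past is summed out by induction on [k], for
    histories that fix only [X k, ..., X n]: splitting over the value of [X k] reduces [k.+1] to
    [k]. *)
Lemma markov_chain_step n a b :
  P [set w | X n w = a /\ X n.+1 w = b] =
  (P [set w | X n w = a] * (K a b)%:E)%E.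
Proof.
pose hist k (c : nat -> S) := [set w | forall m, (k <= m <= n)%N -> X m w = c m].
have mhist k c : measurable (hist k c).
  rewrite (_ : hist k c = \bigcap_(m in [set m | k <= m <= n]%N) [set w | X m w = c m]).
    by apply: bigcap_measurableType => m _; exact: mX.
  by apply/seteqP; split=> w /= H m; exact: H.
suff H k c : (k <= n)%N -> P (hist k c `&` [set w | X n.+1 w = b]) =
    (P (hist k c) * (K (c n) b)%:E)%E.
  have := H n (fun=> a) (leqnn n).
  have -> : hist n (fun=> a) = [set w | X n w = a].
    apply/seteqP; split=> w /= Hw; first by apply: Hw; rewrite leqnn.
    by move=> m; rewrite -eqn_leq => /eqP <-.
  by [].
elim: k c => [c _|k IH c kn].
  by case: hX => _ _ /(_ n c b).
(* [c'] differs from [c] only by the value [s] at time [k]; as [k < n], the last state is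
   unchanged. *)
pose c' s m := if m == k then s else c m.
have histE s : hist k.+1 c `&` [set w | X k w = s] = hist k (c' s).
  apply/seteqP; split=> w /=.
    move=> [Hw Xs] m /andP[km mn]; rewrite /c'; case: eqP => [->//|mk].
    by apply: Hw; rewrite mn andbT; lia.
  move=> Hw; split; last by rewrite Hw ?leqnn ?(ltnW kn)// /c' eqxx.
  move=> m /andP[km mn]; rewrite Hw ?mn ?(ltnW km)// /c'.
  by case: eqP km => // ->; rewrite ltnn.
rewrite (measure_countable_fibres P (mX k)); last exact: measurableI.
rewrite [P (hist k.+1 c)](measure_countable_fibres P (mX k))// muleC.
rewrite -nneseriesZl//; apply: eq_eseriesr => /= j _.
rewrite pickle_fibre; case: pickle_inv => [s|]; last first.
  by rewrite !setI0 measure0 mule0.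
rewrite setIAC histE IH; last exact: ltnW.
by rewrite muleC /c'; case: eqP kn => // ->; rewrite ltnn.
Qed.

(** The states in [s] contribute by finite additivity and the one-step formula. Outside [s] each of
    the countably many fibres of [X n] meets the event in a null set, since [K a b = 0] there. *)
Lemma markov_chain_forward n b (s : seq S) : uniq s ->
  (forall a, a \notin s -> K a b = 0) ->
  P [set w | X n.+1 w = b] = (\sum_(a <- s) P [set w | X n w = a] * (K a b)%:E)%E.
Proof.
move=> us Ks.
have mXs (t : seq S) : measurable [set w | X n w \in t].
  elim: t => [|a t IH]; first by rewrite (_ : mkset _ = set0)// -subset0.
  rewrite (_ : mkset _ = [set w | X n w = a] `|` [set w | X n w \in t]).
    exact: measurableU.
  by apply/seteqP; split=> w /=; rewrite inE => /predU1P.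
have {us}Hs : P ([set w | X n w \in s] `&` [set w | X n.+1 w = b]) =
    (\sum_(a <- s) P [set w | X n w = a] * (K a b)%:E)%E.
  elim: s us {Ks} => [_|a t IH /= /andP[at_ /IH{}IH]].
    by rewrite big_nil (_ : mkset _ = set0) ?set0I ?measure0// -subset0.
  rewrite big_cons -IH -markov_chain_step -measureU.
  - congr (P _); apply/seteqP; split=> w /=; rewrite inE.
      by move=> [/predU1P[] ? ?]; [left|right].
    by move=> [[<-]|[->]]; rewrite ?eqxx ?orbT.
  - exact: measurableI (mX n a) (mX n.+1 b).
  - exact: measurableI.
  - by rewrite -subset0 => w /= [[->] _ []]; rewrite (negPf at_).
rewrite -Hs setIC; apply: etrans (measureDI P (mX n.+1 b) (mXs s)) _.
rewrite [X in (X + _)%E](_ : _ = 0%E) ?add0e//.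
apply: etrans (measure_countable_fibres P (mX n) _) _; first exact: measurableD.
rewrite eseries0// => k _ _.
rewrite pickle_fibre; case: pickle_inv => [a|]; last by rewrite setI0 measure0.
have [as_|as_] := boolP (a \in s).
  rewrite (_ : _ `&` _ = set0) ?measure0// -subset0 => w /= [[_ +]] Xw.
  by rewrite Xw as_.
apply: (subset_measure0 (B := [set w | X n w = a /\ X n.+1 w = b])).
- by apply: measurableI; [exact: measurableD|].
- exact: measurableI (mX n a) (mX n.+1 b).
- by move=> w /= [[? _]].
- by apply: etrans (markov_chain_step _ _ _) _; rewrite (Ks _ as_) mule0.
Qed.

End markov.

(** * The transition operator and its iterates *)

(** This is the action of the transition matrix on functions that vanish at [None]. *)
Definition mfb_op (R : realType) (N : nat) (p0 q0 r0 p q r : R)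
    (f : int -> R) (i : int) : R :=
  if (N%:Z %| i)%Z then p0 * f (i + 1) + q0 * f (i - 1) + r0 * f i
  else p * f (i + 1) + q * f (i - 1) + r * f i.

Section mfb_op.
Context (R : realType) (N : nat) (p0 q0 r0 s0 p q r : R).
Local Notation op := (mfb_op N p0 q0 r0 p q r).
Local Notation tr := (mfb_transition N p0 q0 r0 s0 p q r).

Lemma mfb_op_delta (j i : int) :
  op (fun a => (a == j)%:R) i = tr (Some i) (Some j).
Proof.
rewrite /mfb_op /= ![_ == j]eq_sym.
have [->|_] := eqVneq j (i + 1).
  rewrite (_ : (i + 1 == i - 1) = false); last lia.
  by rewrite (_ : (i + 1 == i) = false); [case: ifP => _; rewrite ?mulr1n ?mulr0n; ring|lia].
have [->|_] := eqVneq j (i - 1).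
  by rewrite (_ : (i - 1 == i) = false); [case: ifP => _; rewrite ?mulr1n ?mulr0n; ring|lia].
by case: eqP => _; case: ifP => _; rewrite ?mulr1n ?mulr0n; ring.
Qed.

Lemma iter_mfb_op_sum (I : Type) (s : seq I) (c : I -> R) (f : I -> int -> R) m i :
  iter m op (fun i => \sum_(a <- s) c a * f a i) i =
  \sum_(a <- s) c a * iter m op (f a) i.
Proof.
elim: m i => // m IH i; rewrite /= /mfb_op !IH.
by case: ifP => _; rewrite !mulr_sumr -!big_split/=;
  apply: eq_bigr => a _; ring.
Qed.

(** By linearity the [k]-th iterate of [f - op f] is a difference of consecutive iterates of [f], so
    the sum telescopes. *)
Lemma iter_mfb_op_sub f m i :
  \sum_(0 <= k < m) iter k op (fun i => f i - op f i) i = f i - iter m op f i.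
Proof.
have H n g : (fun i => iter n op (fun i => f i - g i) i) =
             (fun i => iter n op f i - iter n op g i).
  apply/funext; elim: n => // n IH j /=; rewrite /mfb_op !IH.
  by case: ifP => _; ring.
elim: m => [|m IH]; first by rewrite big_geq// subrr.
rewrite big_nat_recr//= IH.
have /(congr1 (@^~ i)) -> := H m (op f).
by rewrite -iterSr /= addrA subrK.
Qed.

(** Induction on [m] by the forward equation, where only [j - 1], [j] and [j + 1] lead to [j]; the
    innermost [op] turns the indicator of [j] into a combination of the indicators of these three
    states. *)
Lemma markov_chain_mfb (d : measure_display) (T : measurableType d)
    (P : probability T R) (X : nat -> T -> option int) (i0 : int) m j :
  markov_chain P tr (Some i0) X ->
  P [set w | X m w = Some j] = (iter m op (fun a => (a == j)%:R) i0)%:E.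
Proof.
move=> hX; elim: m j => [j|m IH j] /=.
  case: (hX) => mX P0 _.
  have [<-|ij] := eqVneq i0 j; first exact: P0.
  apply/eqP; rewrite eq_le measure_ge0 andbT.
  (* The start already carries probability 1 at time 0, which leaves nothing for another state. *)
  have : (P [set w | X 0%N w = Some i0] + P [set w | X 0%N w = Some j] <= 1)%E.
    apply: le_trans (probability_le1 P (measurableU _ _ (mX 0%N (Some i0)) (mX 0%N (Some j)))).
    rewrite le_eqVlt; apply/orP; left; apply/eqP/esym/measureU => //.
    by rewrite -subset0 => w /= [->] [ij']; rewrite ij' eqxx in ij.
  by rewrite P0 -[leRHS]adde0 leeD2lE.
pose s := [:: j - 1; j; j + 1].
have us : uniq s by rewrite /s /= !inE; lia.
rewrite (@markov_chain_forward _ _ _ _ _ _ _ _ hX m (Some j) (map Some s)); first last.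
- move=> [a|] //; rewrite mem_map; last by move=> ? ? [].
  rewrite !inE /= => sa.
  rewrite (_ : (j == a + 1) = false); last lia.
  rewrite (_ : (j == a - 1) = false); last lia.
  rewrite (_ : (j == a) = false); last lia.
  by case: ifP.
- by rewrite map_inj_uniq// => ? ? [].
rewrite big_map -iterS iterSr.
rewrite (_ : op (fun a => (a == j)%:R) =
   (fun i => \sum_(a <- s) tr (Some a) (Some j) * (i == a)%:R)); last first.
  apply/funext => i; rewrite mfb_op_delta.
  have [is_|is_] := boolP (i \in s).
    rewrite (bigD1_seq i)//= eqxx mulr1 big1 ?addr0// => a ai.
    by rewrite [i == a]eq_sym (negPf ai) mulr0.
  rewrite big1_seq => [|a /andP[_ as_]]; last first.
    by case: eqP as_ is_ => [->->//|]; rewrite mulr0.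
  move: is_; rewrite !inE /= => sa.
  rewrite (_ : (j == i + 1) = false); last lia.
  rewrite (_ : (j == i - 1) = false); last lia.
  rewrite (_ : (j == i) = false); last lia.
  by case: ifP.
rewrite iter_mfb_op_sum -sumEFin.
by apply: eq_bigr => a _; rewrite IH -EFinM mulrC.
Qed.

Hypotheses (p0_ge0 : 0 <= p0) (q0_ge0 : 0 <= q0) (r0_ge0 : 0 <= r0).
Hypotheses (p_ge0 : 0 <= p) (q_ge0 : 0 <= q) (r_ge0 : 0 <= r).

Lemma ler_iter_mfb_op (f g : int -> R) m i : (forall i, f i <= g i) ->
  iter m op f i <= iter m op g i.
Proof.
move=> fg; elim: m i => //= m IH i.
by rewrite /mfb_op; case: ifP => _; rewrite !lerD// ler_wpM2l.
Qed.

Lemma iter_mfb_opZ (c : R) f m i :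
  iter m op (fun i => c * f i) i = c * iter m op f i.
Proof.
elim: m i => //= m IH i; rewrite /mfb_op !IH.
by case: ifP => _; ring.
Qed.

(** [op] is linear and monotone, so the iterates of [f] lie between those of [- h] and [h], which
    are dominated by [theta ^+ m * h]. *)
Lemma cvg_iter_mfb_op (theta : R) (h f : int -> R) i :
  0 <= theta < 1 -> (forall i, op h i <= theta * h i) ->
  (forall i, `|f i| <= h i) -> iter m op f i @[m --> \oo] --> (0 : R).
Proof.
move=> /andP[t0 t1] hh fh.
have H m j : iter m op h j <= theta ^+ m * h j.
  elim: m j => [j|m IH j]; first by rewrite mul1r.
  rewrite iterSr; apply: (@le_trans _ _ (iter m op (fun i => theta * h i) j)).
    exact: ler_iter_mfb_op.
  by rewrite iter_mfb_opZ exprS -mulrA ler_wpM2l.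
apply: (@squeeze_cvgr _ _ _ _ (fun m => - (theta ^+ m * h i)) (fun m => theta ^+ m * h i)).
- near=> m; apply/andP; split.
    rewrite lerNl (le_trans _ (H m i))// -mulN1r -iter_mfb_opZ.
    apply: ler_iter_mfb_op => j; rewrite mulN1r; apply: le_trans (fh j).
    by rewrite -normrN ler_norm.
  apply: le_trans (H m i); apply: ler_iter_mfb_op => j.
  exact: le_trans (ler_norm _) (fh j).
- rewrite -oppr0; apply: cvgN; rewrite -[X in _ --> X](mul0r (h i)); apply: cvgMl.
  by apply: cvg_expr; rewrite ger0_norm.
- rewrite -[X in _ --> X](mul0r (h i)); apply: cvgMl.
  by apply: cvg_expr; rewrite ger0_norm.
Unshelve. all: by end_near. Qed.

End mfb_op.

(** * Functions described block by block *)

Definition block_fun (R : realType) (N : nat) (F : int -> nat -> R) (i : int) : R :=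
  F (i %/ N%:Z)%Z `|(i %% N%:Z)%Z|%N.

Lemma int_blockP (N : nat) (i : int) : (0 < N)%N ->
  exists (a : int) (b : nat), (b < N)%N /\ i = a * N%:Z + b%:Z.
Proof.
move=> N0; exists (i %/ N%:Z)%Z, `|(i %% N%:Z)%Z|%N.
have N0' : N%:Z != 0 by lia.
have := modz_ge0 i N0'; have := ltz_mod i N0'; have := divz_eq i N%:Z; lia.
Qed.

Section mfb_block.
Context (R : realType) (N : nat) (p0 q0 r0 s0 p q r : R).
Hypotheses (N_gt1 : (1 < N)%N).
Local Notation op := (mfb_op N p0 q0 r0 p q r).
Local Notation tr := (mfb_transition N p0 q0 r0 s0 p q r).

(** The compatibility of [F a N] with the next block lets [b] also be [N], so both neighbours of an
    inner point can be read in its own block. *)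
Lemma block_funE (F : int -> nat -> R) (a : int) (b : nat) :
  (forall a, F a N = F (a + 1) 0%N) -> (b <= N)%N ->
  block_fun N F (a * N%:Z + b%:Z) = F a b.
Proof.
move=> FN; have N0 : N%:Z != 0 by lia.
rewrite /block_fun leq_eqVlt => /predU1P[->|bN].
  by rewrite (_ : _ + _ = (a + 1) * N%:Z) ?mulzK// ?modzMl ?FN// mulrDl mul1r.
by rewrite divzMDl// modzMDl divz_small ?modz_small ?addr0//; lia.
Qed.

Lemma mfb_op_block_inner (F : int -> nat -> R) (a : int) (b : nat) :
  (forall a, F a N = F (a + 1) 0%N) -> (b.+2 <= N)%N ->
  op (block_fun N F) (a * N%:Z + b.+1%:Z) =
  p * F a b.+2 + q * F a b + r * F a b.+1.
Proof.
move=> FN bN; rewrite /mfb_op rpredDl ?dvdz_mull//.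
rewrite -[_ \in _]/(N%:Z %| b.+1%:Z)%Z dvdzE /= gtnNdvd//.
rewrite (_ : _ + 1 = a * N%:Z + b.+2%:Z); last lia.
rewrite (_ : _ - 1 = a * N%:Z + b%:Z); last lia.
by rewrite !block_funE//; lia.
Qed.

Lemma mfb_op_block_barrier (F : int -> nat -> R) (a : int) :
  (forall a, F a N = F (a + 1) 0%N) ->
  op (block_fun N F) (a * N%:Z) =
  p0 * F a 1%N + q0 * F (a - 1) (N - 1)%N + r0 * F a 0%N.
Proof.
move=> FN; rewrite /mfb_op dvdz_mull//.
rewrite (_ : _ - 1 = (a - 1) * N%:Z + (N - 1)%N%:Z); last lia.
have -> : block_fun N F (a * N%:Z) = F a 0%N.
  by rewrite -(block_funE a FN (leq0n N)) addr0.
by rewrite (block_funE a FN (ltnW N_gt1)) (block_funE _ FN (leq_subr 1 N)).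
Qed.

(* [C - L ^+ b] decreases in mean on a block since [L] exceeds both roots of
   [p z ^+ 2 - (p + q) z + q]; a barrier counts as the right end [b = N] of the
   block, and [C] is so large that the absorption there beats the gain [L ^+ N]. *)
Lemma mfb_op_contraction
    (p0_gt0 : 0 < p0) (q0_gt0 : 0 < q0) (r0_ge0 : 0 <= r0) (s0_gt0 : 0 < s0)
    (sum0 : p0 + q0 + r0 + s0 = 1)
    (p_gt0 : 0 < p) (q_gt0 : 0 < q) (r_ge0 : 0 <= r) (rE : r = 1 - p - q) :
  exists (theta : R) (h : int -> R),
  [/\ 0 <= theta < 1, forall i, 1 <= h i & forall i, op h i <= theta * h i].
Proof.
(* [L = 1 + q / p]: at an inner point [b.+1] the mean decreases by at least [q * L ^+ b >= q]. *)
have [L pL] : exists L, p * L = p + q.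
  by exists (1 + q / p); rewrite mulrDr mulr1 mulrCA divff ?mulr1// gt_eqF.
(* With this [C] the mean after a barrier is at most [(1 - s0) * C = C - L ^+ N - 1], the value at
   the barrier minus 1. *)
have [C sC] : exists C, s0 * C = L ^+ N + 1.
  by exists ((L ^+ N + 1) / s0); rewrite mulrCA divff ?mulr1// gt_eqF.
pose F (a : int) (b : nat) := C - L ^+ (if b is 0%N then N else b).
have L1 : 1 <= L by rewrite -(ler_pM2l p_gt0) mulr1 pL; lra.
have L0 : 0 <= L by lra.
have Lb b : 1 <= L ^+ b by rewrite exprn_ege1.
have LN b : (b <= N)%N -> L ^+ b <= L ^+ N by move=> bN; rewrite ler_weXn2l.
have FN a : F a N = F (a + 1) 0%N by rewrite /F; case: N N_gt1.
have q1 : q <= 1 by lra.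
have s1 : s0 <= 1 by lra.
have C1 : L ^+ N + 1 <= C.
  by rewrite -sC ger_pMl// -(pmulr_rgt0 _ s0_gt0) sC; have := Lb N; lra.
have C0 : 0 < C by have := Lb N; lra.
have hblock i : 1 <= block_fun N F i <= C.
  have [a [b [bN ->]]] := int_blockP i (ltnW N_gt1).
  rewrite block_funE ?(ltnW bN)// /F; case: b bN => [|b] bN.
    have := Lb N; lra.
  have := Lb b.+1; have := LN b.+1 (ltnW bN); lra.
have hq i : op (block_fun N F) i <= block_fun N F i - q.
  have [a [b [bN ->]]] := int_blockP i (ltnW N_gt1).
  rewrite block_funE ?(ltnW bN)//; case: b bN => [|b] bN.
    rewrite addr0 mfb_op_block_barrier//.
    have H c : p0 * (C - c) = p0 * C - p0 * c by ring.
    have H' c : q0 * (C - c) = q0 * C - q0 * c by ring.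
    have H'' c : r0 * (C - c) = r0 * C - r0 * c by ring.
    rewrite /F H H' H''.
    have := mulr_ge0 (ltW p0_gt0) (le_trans ler01 (Lb 1%N)).
    have := mulr_ge0 r0_ge0 (le_trans ler01 (Lb N)).
    set c := L ^+ (if _ is 0%N then N else _).
    have c0 : 0 <= q0 * c by rewrite mulr_ge0 ?exprn_ge0// ltW.
    have : p0 * C + q0 * C + r0 * C + s0 * C = C by rewrite -!mulrDl sum0 mul1r.
    lra.
  rewrite mfb_op_block_inner//.
  have Fb : F a b <= C - L ^+ b.
    by rewrite /F; case: b bN => [|b] bN//; rewrite lerD2l lerN2 LN.
  have := ler_wpM2l (ltW q_gt0) Fb.
  rewrite /F rE !exprS; set y := L ^+ b.
  have y1 : 1 <= y := Lb b.
  have : q * 1 <= q * y by rewrite ler_wpM2l// ltW.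
  have : p * (L * (L * y)) = (p + q) * (L * y) by rewrite mulrA pL.
  have : p * (L * y) = (p + q) * y by rewrite mulrA pL.
  nra.
(* As the function is at most [C], a decrease by [q] is at least the fraction [q / C] of its
   value. *)
exists (1 - q / C), (block_fun N F); split.
- have : 0 < q / C by rewrite divr_gt0.
  have : q / C <= 1 by rewrite ler_pdivrMr// mul1r; have := Lb N; lra.
  lra.
- by move=> i; case/andP: (hblock i).
- move=> i; apply: le_trans (hq i) _.
  have /andP[_ hC] := hblock i.
  rewrite mulrBl mul1r lerD2l lerN2 -mulrA ler_piMr ?(ltW q_gt0)//.
  by rewrite mulrC ler_pdivrMr// mul1r.
Qed.

(** The equations for [F] say that [f - op f] is the indicator of the origin. Translation by [k]
    blocks moves the target to [k * N], so the start is read in block [- k]. The contraction removes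
    the remainder of the telescoped sum. *)
Lemma expected_arrivals_block (d : measure_display) (T : measurableType d)
    (P : probability T R) (X : nat -> T -> option int) (i0 : nat) (k : int)
    (F : int -> nat -> R) (M : R)
    (p0_gt0 : 0 < p0) (q0_gt0 : 0 < q0) (r0_ge0 : 0 <= r0) (s0_gt0 : 0 < s0)
    (sum0 : p0 + q0 + r0 + s0 = 1)
    (p_gt0 : 0 < p) (q_gt0 : 0 < q) (r_ge0 : 0 <= r) (rE : r = 1 - p - q) :
  markov_chain P tr (Some i0%:Z) X -> (i0 <= N)%N ->
  (forall a, F a N = F (a + 1) 0%N) ->
  (forall a b, (b < N)%N -> `|F a b| <= M) ->
  (forall a b, (b.+2 <= N)%N ->
     p * F a b.+2 + q * F a b + r * F a b.+1 = F a b.+1) ->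
  (forall a, p0 * F a 1%N + q0 * F (a - 1) (N - 1)%N + r0 * F a 0%N =
     F a 0%N - (a == 0)%:R) ->
  expected_arrivals P X (k * N%:Z) = (F (- k) i0)%:E.
Proof.
move=> hX i0N FN FM Fin Fbar.
pose f := block_fun N (fun a => F (a - k)).
have FN' a : F (a - k) N = F (a + 1 - k) 0%N by rewrite FN addrAC.
have fE : (fun i => (i == k * N%:Z)%:R) = (fun i => f i - op f i).
  apply/funext => i.
  have [a [b [bN ->]]] := int_blockP i (ltnW N_gt1).
  rewrite {1}/f block_funE ?(ltnW bN)//; case: b bN => [|b] bN.
    rewrite addr0 /f mfb_op_block_barrier// (_ : a - 1 - k = a - k - 1); last lia.
    rewrite Fbar opprB addrC subrK.
    by rewrite subr_eq0 (inj_eq (mulIf _))//; lia.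
  rewrite /f mfb_op_block_inner// Fin// subrr.
  rewrite (_ : _ == _ = false)//; apply/negbTE/eqP => abk.
  have : (N%:Z %| b.+1%:Z)%Z.
    rewrite (_ : b.+1%:Z = (k - a) * N%:Z); last by rewrite mulrBl -abk; ring.
    exact: dvdz_mull.
  by rewrite dvdzE /= gtnNdvd.
have [theta [h [th h1 hop]]] :=
  mfb_op_contraction p0_gt0 q0_gt0 r0_ge0 s0_gt0 sum0 p_gt0 q_gt0 r_ge0 rE.
have M0 : 0 <= M by apply: le_trans (FM 0 0%N (ltnW N_gt1)).
have fcvg : iter m op f i0%:Z @[m --> \oo] --> (0 : R).
  (* [M * h] dominates the modulus of [f] because [h >= 1]. *)
  apply: (@cvg_iter_mfb_op _ _ _ _ _ _ _ _ _ _ _ _ _ _ theta (fun i => M * h i)) => //; try exact: ltW.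
    by move=> i; have := iter_mfb_opZ N p0 q0 r0 p q r M h 1 i => /= ->; rewrite mulrCA ler_wpM2l.
  move=> i; have [a [b [bN ->]]] := int_blockP i (ltnW N_gt1).
  rewrite /f block_funE ?(ltnW bN)//; apply: le_trans (FM _ _ bN) _.
  by rewrite ler_peMr.
rewrite /expected_arrivals.
rewrite (_ : F (- k) i0 = f i0%:Z); last first.
  by rewrite -[i0%:Z]add0r -(mul0r N%:Z) /f block_funE// add0r.
apply/cvg_lim => //.
rewrite (_ : (fun n => _) = EFin \o (fun m => f i0%:Z - iter m op f i0%:Z)); last first.
  apply/funext => m /=; rewrite -iter_mfb_op_sub -fE -sumEFin.
  by apply: eq_bigr => n _; exact: markov_chain_mfb hX.
apply: cvg_EFin; first exact: nearW.
rewrite -[X in _ --> X]subr0; apply: cvgB => //; exact: cvg_cst.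
Qed.

End mfb_block.

(** * The quadratic equation and the explicit solution *)

(** The parabola opens upwards and is negative at 1, so its roots lie on either side of 1; their
    product [c / a] is positive, hence so is the smaller root. *)
Lemma quadratic_roots_around1 (R : realType) (a b c : R) :
  0 < a -> 0 < c -> a + b + c < 0 ->
  let D := Num.sqrt (b ^+ 2 - 4 * a * c) in
  exists x1 x2 : R,
    [/\ solutions_quadratic a b c x1 x2, [/\ 1 < x1, x2 < 1 & 0 < x2],
        a * (x1 - x2) = D & 0 < D].
Proof.
move=> a0 c0 abc D.
have DD : 0 < b ^+ 2 - 4 * a * c.
  (* As [b < - (a + c) < 0], [b ^+ 2] exceeds [(a + c) ^+ 2 = (a - c) ^+ 2 + 4 * a * c]. *)
  have := sqr_ge0 (a - c); rewrite !expr2; nra.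
have D0 : 0 < D by rewrite /D sqrtr_gt0.
have D2 : D * D = b * b - 4 * a * c.
  by rewrite -expr2 sqr_sqrtr ?expr2// -expr2 ltW.
have a2 : 2 * a != 0 by rewrite mulf_neq0 ?gt_eqF// ltr0n.
have [x1 e1] : exists x, 2 * a * x = - b + D.
  by exists ((- b + D) / (2 * a)); rewrite mulrC divfK.
have [x2 e2] : exists x, 2 * a * x = - b - D.
  by exists ((- b - D) / (2 * a)); rewrite mulrC divfK.
clearbody D.
have es : a * (x1 + x2) = - b by lra.
have ed : a * (x1 - x2) = D by lra.
have ep : a * x1 * x2 = c.
  apply: (mulfI a2); apply: (mulfI a2).
  rewrite (_ : 2 * a * (2 * a * (a * x1 * x2)) = a * ((2 * a * x1) * (2 * a * x2))); last ring.
  rewrite e1 e2 (_ : (- b + D) * (- b - D) = b * b - D * D); last ring.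
  by rewrite D2; ring.
have fE z : a * z ^+ 2 + b * z + c = a * ((z - x1) * (z - x2)).
  by rewrite -ep -[b]opprK -es; ring.
have x12 : x2 < x1 by rewrite -subr_gt0 -(pmulr_rgt0 _ a0) ed.
have f1 : (1 - x1) * (1 - x2) < 0.
  by rewrite -(pmulr_rlt0 _ a0) -fE expr1n !mulr1.
have g1 : 1 < x1 by rewrite ltNge; apply/negP => ?; nra.
have g2 : x2 < 1 by rewrite ltNge; apply/negP => ?; nra.
exists x1, x2; split=> //.
  move=> z; rewrite fE; split.
    move=> /eqP; rewrite !mulf_eq0 gt_eqF//= !subr_eq0.
    by move=> /orP[/eqP|/eqP]; [left|right].
  by move=> [->|->]; rewrite subrr ?mul0r ?mulr0.
split=> //.
by rewrite -(pmulr_rgt0 _ (lt_trans ltr01 g1)) -(pmulr_rgt0 _ a0) mulrA ep.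
Qed.

(* [G n] is [l1 ^+ n - l2 ^+ n] if [rho != 1] and [n%:R] if [rho = 1]. *)
Lemma mfb_arrivals (R : realType) (d : measure_display) (T : measurableType d)
    (P : probability T R) (N i0 : nat) (p0 q0 r0 s0 p q r rho : R)
    (G : nat -> R) (X : nat -> T -> option int) :
  (1 < N)%N -> (i0 < N)%N ->
  0 < p0 -> 0 < q0 -> 0 <= r0 -> 0 < s0 -> p0 + q0 + r0 + s0 = 1 ->
  0 < p -> 0 < q -> 0 <= r -> r = 1 - p - q -> p = rho * q ->
  G 0%N = 0 -> 0 < G 1%N -> (forall n, G n.+1 = rho * G n + G 1%N) ->
  markov_chain P (mfb_transition N p0 q0 r0 s0 p q r) (Some i0%:Z) X ->
  let a := q0 * G 1%N in
  let b := G (N - 1)%N * (p0 + q0 * rho) - (1 - r0) * G N in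
  let c := p0 * rho ^+ (N - 1) * G 1%N in
  let H xi := G (N - i0)%N * xi + rho ^+ (N - i0) * G i0 in
  exists xi1 xi2 : R,
    [/\ solutions_quadratic a b c xi1 xi2, [/\ 1 < xi1, xi2 < 1 & 0 < xi2],
        forall k : int, k <= 0 -> expected_arrivals P X (k * N%:Z) =
          (H xi1 / Num.sqrt (b ^+ 2 - 4 * a * c) * xi1 ^ (k - 1))%:E &
        forall k : int, 1 <= k -> expected_arrivals P X (k * N%:Z) =
          (H xi2 / Num.sqrt (b ^+ 2 - 4 * a * c) * xi2 ^ (k - 1))%:E].
Proof.
move=> N1 i0N p0_gt0 q0_gt0 r0_ge0 s0_gt0 sum0 p_gt0 q_gt0 r_ge0 rE pE G0 G1 GS hX.
move=> a b c H0.
have rho_gt0 : 0 < rho by rewrite -(pmulr_lgt0 _ q_gt0) -pE.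
(* [G n] is [G 1] times a geometric sum of ratio [rho], so the highest power can be split off as
   well as the constant term. *)
have GSr n : G n.+1 = G n + rho ^+ n * G 1%N.
  elim: n => [|n IH]; first by rewrite G0 add0r mul1r.
  by rewrite GS {1}IH mulrDr mulrA -exprS addrAC -GS.
have G_gt0 n : 0 < G n.+1.
  elim: n => // n IH; rewrite GS addr_gt0// mulr_gt0//.
have a_gt0 : 0 < a by rewrite mulr_gt0.
have c_gt0 : 0 < c by rewrite !mulr_gt0// exprn_gt0.
(* The quadratic at 1: the two recursions collect its terms into [q0 * G N] and [p0 * G N], and
   [p0 + q0 + r0 - 1 = - s0]. *)
have abc : a + b + c = - s0 * G N.
  rewrite /a /b /c; case: N N1 {i0N hX a b c H0 a_gt0 c_gt0} => // n _.
  rewrite subn1 /= (_ : s0 = 1 - p0 - q0 - r0); last by rewrite -sum0; ring.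
  have E1 := GS n; have E2 := GSr n.
  have E3 : G 1%N = G n.+1 - rho * G n by rewrite E1; ring.
  have E4 : rho ^+ n * G 1%N = G n.+1 - G n by rewrite E2; ring.
  by rewrite -[p0 * _ * _]mulrA E4 E3; ring.
have abc_lt0 : a + b + c < 0.
  by rewrite abc mulNr oppr_lt0 mulr_gt0//; case: N N1 {i0N hX a b c H0 a_gt0 c_gt0 abc}.
have [x1 [x2 [hs [x1_gt1 x2_lt1 x2_gt0] xD D_gt0]]] :=
  quadratic_roots_around1 a_gt0 c_gt0 abc_lt0.
set D := Num.sqrt _ in xD D_gt0 *.
exists x1, x2.
(* Here [k] is the block relative to the target. The powers [xi ^ (- k - 1)] stay bounded on the
   right with the root above 1, on the left with the root below 1. *)
pose xi (k : int) := if 0 <= k then x1 else x2.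
(* Both [G (N - n)] and [rho ^+ (N - n) * G n] solve the recurrence; they vanish at [N] and at 0.
   The end values [G N * x] and [G N] make blocks with the same root fit together. *)
pose H x n := G (N - n)%N * x + rho ^+ (N - n) * G n.
pose F k n := H (xi k) n / D * xi k ^ (- k - 1).
have x1_gt0 : 0 < x1 := lt_trans ltr01 x1_gt1.
have xi_gt0 k : 0 < xi k by rewrite /xi; case: ifP.
have H0E x : H x 0%N = G N * x by rewrite /H subn0 G0 mulr0 addr0.
have HNE x : H x N = G N by rewrite /H subnn G0 mul0r mul1r add0r.
have xiS k : xi k * xi k ^ (- k - 1) = xi k ^ (- k).
  by rewrite -{1}[xi k]expr1z -expfzDr ?gt_eqF// addrC subrK.
have F0E k : F k 0%N = G N / D * xi k ^ (- k).
  by rewrite /F H0E -xiS; ring.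
have FN k : F k N = F (k + 1) 0%N.
  rewrite F0E /F HNE -opprD.
  (* The root changes between the blocks -1 and 0, where both exponents are 0. *)
  have [->|k1] := eqVneq k (-1); first by rewrite addNr oppr0 !expr0z.
  rewrite (_ : xi (k + 1) = xi k)// /xi (_ : (0 <= k + 1) = (0 <= k))//.
  by move: k1; clear; lia.
(* Summing over all [m < N] and both roots gives a bound free of [k] and [n]. *)
have FM k n : (n < N)%N -> `|F k n| <= \sum_(m < N) (`|H x1 m / D| + `|H x2 m / D|).
  move=> nN.
  have xik : `|xi k ^ (- k - 1)| <= 1.
    rewrite ger0_norm; last by rewrite exprz_ge0// ltW.
    rewrite /xi; case: (leP 0 k) => k0.
      rewrite (_ : - k - 1 = - (`|k|%N.+1%:Z)); last by move: k0; clear; lia.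
      by rewrite -exprnN invf_le1 ?exprn_gt0// exprn_ege1// ltW.
    rewrite (_ : - k - 1 = (`|k|%N.-1)%:Z); last by move: k0; clear; lia.
    by rewrite -exprnP exprn_ile1// ltW.
  rewrite (bigD1 (Ordinal nN))//= /F normrM.
  apply: le_trans (ler_piMr (normr_ge0 _) xik) _.
  rewrite -[leLHS]addr0 lerD ?sumr_ge0//.
  by rewrite /xi; case: ifP => _; rewrite ?lerDl ?lerDr.
have Fin k n : (n.+2 <= N)%N ->
    p * F k n.+2 + q * F k n + r * F k n.+1 = F k n.+1.
  move=> nN; rewrite /F.
  have -> : p * (H (xi k) n.+2 / D * xi k ^ (- k - 1)) +
    q * (H (xi k) n / D * xi k ^ (- k - 1)) +
    r * (H (xi k) n.+1 / D * xi k ^ (- k - 1)) =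
    (p * H (xi k) n.+2 + q * H (xi k) n + r * H (xi k) n.+1) / D
     * xi k ^ (- k - 1) by ring.
  congr (_ / _ * _); rewrite /H.
  have [m ->] : exists m, N = (m + n.+2)%N by exists (N - n.+2)%N; rewrite subnK.
  rewrite addnK.
  rewrite (_ : m + n.+2 - n.+1 = m.+1)%N; last by clear; lia.
  rewrite (_ : m + n.+2 - n = m.+2)%N; last by clear; lia.
  rewrite !exprS (GS n.+1) (GS n) (GS m.+1) (GS m) rE pE; ring.
(* Up to a common factor, the quadratic is the defect of the barrier equation for a single root, so
   it vanishes at [x1] and [x2]. *)
have H1 x : p0 * H x 1%N + q0 * H x (N - 1)%N * x = (1 - r0) * G N * x
  + (a * x ^+ 2 + b * x + c).
  rewrite /H subKn ?(ltnW N1)// /a /b /c.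
  have -> : rho ^+ 1 = rho by [].
  ring.
have Hx k : p0 * H (xi k) 1%N + q0 * H (xi k) (N - 1)%N * xi k = (1 - r0) * G N * xi k.
  rewrite H1 (_ : _ + c = 0) ?addr0//; apply/hs.
  by rewrite /xi; case: ifP; [left|right].
have Fbar k : p0 * F k 1%N + q0 * F (k - 1) (N - 1)%N + r0 * F k 0%N =
     F k 0%N - (k == 0)%:R.
  have [->|k0] := eqVneq k 0.
    (* At the target the left neighbour uses [x2] in place of [x1]. The resulting defect is
       [q0 * G 1 * (x1 - x2) / D = 1], which is why [H] is divided by [D]. *)
    have x1x2 : H x1 (N - 1)%N - H x2 (N - 1)%N = G 1%N * (x1 - x2).
      by rewrite /H subKn ?(ltnW N1)//; ring.
    have Hx0 := Hx 0; rewrite /xi lexx in Hx0.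
    rewrite F0E oppr0 !expr0z mulr1 mulr1n sub0r /F oppr0 sub0r subrr expr0z mulr1.
    rewrite (_ : xi 0 = x1)// (_ : xi (-1) = x2)// (_ : x1 ^ (-1) = x1^-1)//.
    have -> : p0 * (H x1 1%N / D / x1) =
        ((1 - r0) * G N - q0 * H x1 (N - 1)%N) / D.
      rewrite [RHS](_ : _ = ((1 - r0) * G N * x1 - q0 * H x1 (N - 1)%N * x1) / D / x1).
        by rewrite -Hx0; field; rewrite !gt_eqF.
      by field; rewrite !gt_eqF.
    have xH : q0 * (H x1 (N - 1)%N - H x2 (N - 1)%N) / D = 1.
      by rewrite x1x2 mulrA xD divff ?gt_eqF.
    by rewrite -[X in _ = _ - X]xH; ring.
  rewrite subr0 F0E -xiS /F.
  rewrite (_ : xi (k - 1) = xi k); last first.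
    by rewrite /xi (_ : (0 <= k - 1) = (0 <= k))//; move: k0; clear; lia.
  rewrite (_ : - (k - 1) - 1 = - k); last by clear; lia.
  rewrite -xiS.
  have := Hx k; set e := xi k ^ _; set y := xi k => Hy.
  rewrite [RHS](_ : _ = ((1 - r0) * G N * y) / D * e + r0 * (G N / D * (y * e))).
    by rewrite -Hy; ring.
  by ring.
have xE k : expected_arrivals P X (k * N%:Z) = (F (- k) i0)%:E.
  exact: (expected_arrivals_block N1 k p0_gt0 q0_gt0 r0_ge0 s0_gt0 sum0 p_gt0
    q_gt0 r_ge0 rE hX (ltnW i0N) FN FM Fin Fbar).
(* The start lies in block [- k] relative to the target, so [k <= 0] selects [x1] and [1 <= k]
   selects [x2]. *)
split=> // k k0; rewrite xE /F opprK.
  by rewrite (_ : xi (- k) = x1)// /xi oppr_ge0 k0.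
by rewrite (_ : xi (- k) = x2)// /xi oppr_ge0 leNgt (lt_le_trans ltr01).
Qed.

(** * The cases [rho != 1] and [rho = 1] *)

Theorem theorem7 (R : realType) (d : measure_display) (T : measurableType d)
    (P : probability T R) (N i0 : nat) (p0 q0 r0 s0 p q r l1 l2 : R)
    (X : nat -> T -> option int)
    (hN : (1 < N)%N) (hi0 : (i0 < N)%N)
    (hp0 : 0 < p0) (hq0 : 0 < q0) (hr0 : 0 <= r0) (hs0 : 0 < s0)
    (hsum0 : p0 + q0 + r0 + s0 = 1)
    (hp : 0 < p) (hq : 0 < q) (hr : 0 <= r) (hrE : r = 1 - p - q)
    (hl : solutions_quadratic q (- (1 - r)) p l1 l2) (hl12 : l2 <= l1)
    (hX : markov_chain P (mfb_transition N p0 q0 r0 s0 p q r)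
            (Some i0%:Z) X) :
  let rho := p / q in
  let x := fun k : int => expected_arrivals P X (k * N%:Z) in
  (rho != 1 ->
   let omega0 := (l2 ^+ N - l1 ^+ N) * (1 - r0)
                 + (l1 ^+ (N - 1) - l2 ^+ (N - 1)) * (p0 + q0 * rho) in
   let Omega := (Num.sqrt (omega0 ^+ 2
                   - 4 * p0 * q0 * (1 - rho) ^+ 2 * rho ^+ (N - 1)))^-1 in
   let A := fun xi : R => (l1 ^+ (N - i0) - l2 ^+ (N - i0)) * xi
                          + rho ^+ N * (l2 ^- i0 - l1 ^- i0) in
   exists xi1 xi2 : R,
     [/\ solutions_quadratic ((l1 - l2) * q0) omega0
           ((l1 - l2) * p0 * rho ^+ (N - 1)) xi1 xi2,
         [/\ 1 < xi1, xi2 < 1 & 0 < xi2],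
         forall k : int, k <= 0 -> x k = (A xi1 * Omega * xi1 ^ (k - 1))%:E &
         forall k : int, 1 <= k -> x k = (A xi2 * Omega * xi2 ^ (k - 1))%:E])
  /\
  (rho = 1 ->
   let D := Num.sqrt ((p0 + q0 + N%:R * s0) ^+ 2 - 4 * p0 * q0) in
   let A := fun xi : R => (N - i0)%:R * xi + i0%:R in
   exists xi1 xi2 : R,
     [/\ solutions_quadratic q0 (- (p0 + q0 + N%:R * s0)) p0 xi1 xi2,
         [/\ 1 < xi1, xi2 < 1 & 0 < xi2],
         forall k : int, k <= 0 -> x k = (A xi1 * xi1 ^ (k - 1) / D)%:E &
         forall k : int, 1 <= k -> x k = (A xi2 * xi2 ^ (k - 1) / D)%:E]).
Proof.
move=> rho x; have pE : p = rho * q by rewrite /rho divfK ?gt_eqF.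
split=> rho1.
  move=> omega0 Omega A.
  (* Both 1 and [rho] solve the equation of [l1] and [l2]; being different, they exhaust its
     solutions. *)
  have hl' : (l1 = 1 /\ l2 = rho) \/ (l1 = rho /\ l2 = 1).
    have h1 : 1 = l1 \/ 1 = l2 by apply/hl; rewrite hrE; ring.
    have h2 : rho = l1 \/ rho = l2 by apply/hl; rewrite hrE pE; ring.
    case: h1 h2 => [<-|<-] [h|h]; rewrite -h; do ?[by left|by right].
      by rewrite h eqxx in rho1.
    by rewrite h eqxx in rho1.
  pose G n := l1 ^+ n - l2 ^+ n.
  have G1 : 0 < G 1%N.
    rewrite /G !expr1 subr_gt0 lt_neqAle hl12 andbT.
    by case: hl' => -[-> ->]; rewrite // eq_sym.
  have GS n : G n.+1 = rho * G n + G 1%N.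
    by rewrite /G; case: hl' => -[-> ->]; rewrite !exprS !expr1n; ring.
  have G0 : G 0%N = 0 by rewrite /G subrr.
  have l12 : l1 * l2 = rho by case: hl' => -[-> ->]; rewrite ?mul1r ?mulr1.
  have rho_gt0 : 0 < rho by rewrite divr_gt0.
  have l1_neq0 : l1 != 0.
    by case: hl' => -[-> _]; rewrite ?oner_eq0// gt_eqF.
  have l2_neq0 : l2 != 0.
    by case: hl' => -[_ ->]; rewrite ?oner_eq0// gt_eqF.
  (* [l1 - l2] is [1 - rho] up to sign, which brings the discriminant into the form in [Omega]. *)
  have G1sq : G 1%N ^+ 2 = (1 - rho) ^+ 2.
    by rewrite /G; case: hl' => -[-> ->]; ring.
  have [xi1 [xi2 []]] :=
    mfb_arrivals hN hi0 hp0 hq0 hr0 hs0 hsum0 hp hq hr hrE pE G0 G1 GS hX.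
  rewrite (_ : _ - (1 - r0) * _ = omega0); last by rewrite /omega0 /G; ring.
  rewrite (_ : q0 * _ = (l1 - l2) * q0); last by rewrite /G; ring.
  rewrite (_ : p0 * _ * _ = (l1 - l2) * p0 * rho ^+ (N - 1)); last by rewrite /G; ring.
  rewrite (_ : omega0 ^+ 2 - _ =
    omega0 ^+ 2 - 4 * p0 * q0 * (1 - rho) ^+ 2 * rho ^+ (N - 1)); last first.
    by rewrite -G1sq /G; ring.
  have AE xi : G (N - i0)%N * xi + rho ^+ (N - i0) * G i0 = A xi.
    (* Splitting [rho ^+ N] by [rho = l1 * l2] cancels the inverse powers and leaves
       [rho ^+ (N - i0) * G i0]. *)
    rewrite /A (_ : rho ^+ N = rho ^+ (N - i0) * (l1 ^+ i0 * l2 ^+ i0)); last first.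
      by rewrite -exprMn l12 -exprD subnK// ltnW.
    by rewrite /G; field; rewrite !expf_neq0.
  move=> hs hxi h1 h2; exists xi1, xi2; split=> // k hk; rewrite -AE.
    exact: h1.
  exact: h2.
move=> D A.
have G0 : 0%:R = 0 :> R by [].
have G1 : 0 < 1%:R :> R by rewrite ltr01.
have GS n : n.+1%:R = rho * n%:R + 1%:R :> R by rewrite rho1 mul1r natr1.
have [xi1 [xi2 []]] := mfb_arrivals (G := fun n => n%:R)
  hN hi0 hp0 hq0 hr0 hs0 hsum0 hp hq hr hrE pE G0 G1 GS hX.
rewrite rho1 !expr1n !mulr1.
have N1 : (N - 1)%:R = N%:R - 1 :> R by rewrite natrB// ltnW.
(* With [G n = n] the coefficient is [(N - 1) * (p0 + q0) - (1 - r0) * N], and the total mass 1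
   brings in [s0]. *)
rewrite (_ : _ - (1 - r0) * _ = - (p0 + q0 + N%:R * s0)); last first.
  by rewrite N1 (_ : s0 = 1 - p0 - q0 - r0); [ring|rewrite -hsum0; ring].
rewrite (_ : (- _) ^+ 2 - 4 * q0 * p0 = (p0 + q0 + N%:R * s0) ^+ 2 - 4 * p0 * q0); last ring.
move=> hs hxi h1 h2; exists xi1, xi2; split=> // k hk.
  by rewrite /x h1//; congr EFin; rewrite /A mul1r; ring.
by rewrite /x h2//; congr EFin; rewrite /A mul1r; ring.
Qed.
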